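(* Let $a<b$ be real numbers and let $f:[a,b]\to\mathbb{R}$ be a function such that $f'$ is absolutely continuous on $[a,b]$ and $f''\in L_1[a,b]$. Let $q>1$ and let $p$ satisfy $\frac1p+\frac1q=1$. If $|f''|^q$ is concave on $[a,b]$, then for all $x\in\left[a,\frac{a+b}{2}\right]$, $$\left|\frac{1}{b-a}\int_a^b f(t)\,dt-\frac12\left[f(x)+f(a+b-x)\right]+\frac12\left(x-\frac{3a+b}{4}\right)\left[f'(x)-f'(a+b-x)\right]\right|$$ $$\le \frac{1}{2(b-a)(2p+1)^{\frac1p}}\left[(x-a)^3\left|f''\left(\frac{x+a}{2}\right)\right|+\frac{(a+b-2x)^3}{4}\left|f''\left(\frac{a+b}{2}\right)\right|+(x-a)^3\left|f''\left(\frac{a+2b-x}{2}\right)\right|\right].$$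
   Context: The derivatives $f'$ and $f''$ are the first and second derivatives of $f$ on $[a,b]$ (one-sided at the endpoints); the hypothesis that $|f''|^q$ is concave on $[a,b]$ is understood to include that $f''$ is defined on $[a,b]$. $L_1[a,b]$ is the space of Lebesgue integrable functions on $[a,b]$. *)

(* Defs.v *)
From HB Require Import structures.
From mathcomp Require Import all_boot all_order all_algebra.
From mathcomp Require Import all_classical all_reals all_analysis.

Set Implicit Arguments.
Unset Strict Implicit.
Unset Printing Implicit Defensive.

Import Order.TTheory GRing.Theory Num.Theory.
Import numFieldNormedType.Exports.

Local Open Scope classical_set_scope.
Local Open Scope convex_scope.
Local Open Scope ring_scope.

(* Variants of [derivable _ _ 1] and [derive1] in which the increment [h] is
   constrained by [h + x \in A].  For [A = `[a, b]] with [a < b], this is the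
   ordinary derivative at interior points and the one-sided derivative at
   [a] and [b]; it depends only on the values of [f] on [`[a, b]]. *)
Definition derivable1_within (R : realType) (A : set R) (f : R -> R) (x : R) :
    Prop :=
  cvg ((fun h => h^-1 *: (f (h + x) - f x)) @
         within [set h | A (h + x)] 0^').

Definition derive1_within (R : realType) (A : set R) (f : R -> R) (x : R) : R :=
  lim ((fun h => h^-1 *: (f (h + x) - f x)) @
         within [set h | A (h + x)] 0^').

Definition absolutely_continuous (R : realType) (a b : R) (g : R -> R) : Prop :=
  forall e : R, 0 < e -> exists2 d : R, 0 < d &
    forall (n : nat) (u v : 'I_n -> R),
      (forall i, [/\ a <= u i, u i < v i & v i <= b]) ->
      trivIset [set: 'I_n] (fun i => `]u i, v i[%classic) ->
      \sum_(i < n) (v i - u i) < d ->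
      \sum_(i < n) `|g (v i) - g (u i)| < e.

(* Same format as the library's [convex_function]: convexity of [D] is not
   part of the definition. *)
Definition concave_function (R : numFieldType) (E : lmodType R)
    (E' := convex_lmodType E) (D : set E') (f : E' -> R^o) : Prop :=
  forall t : {i01 R},
    {in D &, forall x y : E', (f x <| t |> f y <= f (x <| t |> y))%R}.

(* Main.v *)
Require Import Defs.
From HB Require Import structures.
From mathcomp Require Import all_boot all_order all_algebra.
From mathcomp Require Import all_classical all_reals all_analysis.
From mathcomp Require Import ring lra.

Set Implicit Arguments.
Unset Strict Implicit.
Unset Printing Implicit Defensive.

Import Order.TTheory GRing.Theory Num.Theory.
Import numFieldNormedType.Exports.

Local Open Scope classical_set_scope.
Local Open Scope ring_scope.

(** For a centre [c], integrating [(t - c)^2 / 2 * f''(t)] by parts twice gives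
    the primitive [G_c(t) = (t - c)^2 / 2 * f'(t) - (t - c) * f(t) + \int_a^t f]
    ([quadratic_primitive]).  Cut [[a, b]] at [x] and [y = a + b - x] and use
    the centres [a], [(a + b) / 2] and [b] on the three pieces.  At the cuts
    the coefficients of [f] and [f'] add up so that the sum of the three
    increments of [G_c] is [b - a] times the quantity to be bounded.

    It remains to bound one increment [G_c(v) - G_c(u)] ([increment_bound]).
    Integrating [(t - c)^2 / 2 * |f''(t)|], Hoelder's inequality produces the
    [L^p] norm of [(t - c)^2], hence the factor [(2 p + 1)^(-1/p)], and the
    [L^q] norm of [f''], which the Hermite-Hadamard inequality for the concave
    function [|f''|^q] bounds by its value at the midpoint [m].  Both
    inequalities have pointwise proofs, and it is these that are used: Young's
    inequality for the normalised factors, and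
    [|f''(t)|^q <= |f''(m)|^q + s * (t - m)] for a supporting slope [s]
    ([concave_supporting_line]).  Together they dominate [|G_c'|] by a function
    with an explicit primitive, so that the mean value theorem
    ([le_increment]) replaces all integration of [f'']; the only genuine
    integral is that of the continuous function [f].  The linear term in
    [t - m] integrates to zero over [[u, v]], [m] being the midpoint. *)

(** * Derivatives within a closed interval *)

(** The constraint on the increment disappears at an interior point, because
    every small enough increment satisfies it. *)
Lemma derive1_within_interior (R : realType) (a b : R) (f : R -> R) (t : R) :
  t \in `]a, b[ -> derivable1_within `[a, b] f t ->
  is_derive t 1 f (derive1_within `[a, b] f t).
Proof.
move=> tab dft.
have E : within [set h | `[a, b]%classic (h + t)] 0^' = 0^'.
  have nb : \forall h \near (0 : R)^', `[a, b]%classic (h + t).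
    apply: nbhs_dnbhs.
    have : \forall h \near (0 : R), h + t \in `]a, b[.
      have c : (fun h => h + t) @ (0 : R) --> t.
        rewrite -[X in _ --> X]add0r.
        by apply: cvgD; [exact: cvg_id|exact: cvg_cst].
      exact: c _ (near_in_itvoo tab).
    by apply: filterS => h /=; rewrite !in_itv/= => /andP[/ltW -> /ltW ->].
  apply/seteqP; split => A HA; last by apply: filterS HA => h Ah _.
  by apply: filterS2 (HA : 0^' _) nb => h; exact.
have Ef : (fun h : R => h^-1 *: (f (h *: 1 + t) - f t)) =
          (fun h => h^-1 *: (f (h + t) - f t)).
  by apply/funext => h; rewrite /GRing.scale /= mulr1.
move: dft; rewrite /derivable1_within /derive1_within E -Ef => dft.
by apply: DeriveDef.
Unshelve. all: by end_near. Qed.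

Lemma derivable1_within_continuous (R : realType) (A : set R) (f : R -> R) :
  (forall t, t \in A -> derivable1_within A f t) -> {within A, continuous f}.
Proof.
move=> df; apply/subspace_continuousP => /= t At.
have {}df : derivable1_within A f t by apply: df; exact/mem_set.
have cvgh : (f (h + t) - f t) @[h --> within [set h | A (h + t)] 0^'] --> 0.
  rewrite -[X in _ --> X](mul0r (derive1_within A f t)).
  have h0 : h @[h --> within [set h | A (h + t)] (0 : R)^'] --> (0 : R).
    by move=> B B0; apply: cvg_within; apply: nbhs_dnbhs.
  apply: cvg_trans (cvgM h0 df); apply: near_eq_cvg.
  near=> h => /=; rewrite /GRing.scale /= mulrA mulfV ?mul1r//.
  by near: h; apply: filterS (nbhs_dnbhs_neq (0 : R)) => h h0' _.
apply/cvgrPdist_lt => e e0.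
move/cvgrPdist_lt : cvgh => /(_ e e0) /nbhs_ballP[d /= d0 H].
apply/nbhs_ballP; exists d => //= s /= ts As.
have [->|nst] := eqVneq s t; first by rewrite subrr normr0.
have := H (s - t); rewrite /= subrK sub0r opprB; apply => //.
  by rewrite /ball /= sub0r normrN distrC.
by rewrite subr_eq0.
Unshelve. all: by end_near. Qed.

(** * Concave functions *)

Lemma sub_concave_function (R : realType) (A B : set R^o) (h : R -> R) :
  B `<=` A -> concave_function A h -> concave_function B h.
Proof.
move=> BA hc t x y /set_mem/BA/mem_set xA /set_mem/BA/mem_set yA.
exact: hc.
Qed.

(** The slopes of the chords from [m] to points on its right are bounded by
    those of the chords from points on its left, so their supremum is a
    supporting slope on both sides. *)
Lemma concave_supporting_line (R : realType) (a b m : R) (h : R -> R) :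
  concave_function (`[a, b]%classic : set R^o) h -> m \in `]a, b[ ->
  exists s, {in `[a, b], forall t, h t <= h m + s * (t - m)}.
Proof.
move=> hc /[dup] mab; rewrite in_itv/= => /andP[am mb].
(* [m] is the convex combination of [u] and [v] in which [u] has the weight
   [(v - m) / (v - u)]. *)
have three u v : a <= u -> u < m -> m < v -> v <= b ->
    (h v - h m) / (v - m) <= (h m - h u) / (m - u).
  move=> au um mv vb.
  have l0 : 0 <= (v - m) / (v - u) by apply: divr_ge0; lra.
  have l1 : (v - m) / (v - u) <= 1 by rewrite ler_pdivrMr; lra.
  have uab : u \in `[a, b]%classic by rewrite inE/= in_itv/=; apply/andP; lra.
  have vab : v \in `[a, b]%classic by rewrite inE/= in_itv/=; apply/andP; lra.
  have /= := hc (Itv01 l0 l1) u v uab vab.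
  rewrite !convRE /=.
  have -> : conv (Itv01 l0 l1) (u : convex_lmodType R^o) v = m.
    rewrite /conv /= /GRing.scale /= /unstable.onem; field; lra.
  rewrite /unstable.onem => H.
  rewrite ler_pdivrMr ?subr_gt0// mulrAC ler_pdivlMr ?subr_gt0//.
  have : ((v - m) / (v - u) * h u + (1 - (v - m) / (v - u)) * h v) * (v - u) <=
      h m * (v - u) by rewrite ler_wpM2r//; lra.
  have -> : ((v - m) / (v - u) * h u + (1 - (v - m) / (v - u)) * h v) * (v - u)
    = (v - m) * h u + (m - u) * h v by field; lra.
  lra.
pose S := [set (h v - h m) / (v - m) | v in `]m, b]].
have S0 : S !=set0.
  by exists ((h b - h m) / (b - m)), b => //=; rewrite in_itv/= mb lexx.
have Sub u : a <= u -> u < m -> ubound S ((h m - h u) / (m - u)).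
  move=> au um _ [v /= + <-]; rewrite in_itv/= => /andP[mv vb].
  exact: three.
exists (sup S) => t; rewrite in_itv/= => /andP[at_ tb].
have [tm|mt|->] := ltgtP t m; last by rewrite subrr mulr0 addr0.
- have : sup S <= (h m - h t) / (m - t) by apply: ge_sup => //; exact: Sub.
  by rewrite ler_pdivlMr ?subr_gt0//; lra.
- have : (h t - h m) / (t - m) <= sup S.
    apply: ub_le_sup; first by exists ((h m - h a) / (m - a)); exact: Sub.
    by exists t => //=; rewrite in_itv/= mt tb.
  by rewrite ler_pdivrMr ?subr_gt0//; lra.
Qed.

(** * Mean value estimates *)

(** [t * (t^2)^p / (2 p + 1)] is a primitive of [|t|^(2 p)], on both sides of
    the origin at once.  At the origin [powR] is not differentiable and the
    chain rule is of no use, but the difference quotient is [(h^2)^p], which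
    tends to [0] since it is at most [h^2] for [|h| <= 1]. *)
Lemma is_derive_mul_sqr_powR (R : realType) (p t : R) : 1 < p ->
  is_derive t 1 (fun t : R => t * (t ^+ 2) `^ p) ((2 * p + 1) * (t ^+ 2) `^ p).
Proof.
move=> p1; have [->|t0] := eqVneq t 0.
  rewrite expr0n /= powR0 ?mulr0; last lra.
  have H : (fun h : R => h^-1 *: ((h *: 1 + 0) * ((h *: 1 + 0) ^+ 2) `^ p -
      0 * (0 ^+ 2) `^ p)) @ 0^' --> 0.
    apply/cvgrPdist_le => e e0; near=> h.
    have h0 : h != 0 by near: h; exact: nbhs_dnbhs_neq.
    have h1 : `|h| <= 1 by near: h; apply: dnbhs0_le.
    have he : `|h| <= e by near: h; apply: dnbhs0_le.
    rewrite /GRing.scale /= addr0 mulr1 mul0r subr0 mulKf// sub0r normrN.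
    rewrite ger0_norm ?powR_ge0//.
    have hh : 0 <= h ^+ 2 <= 1.
      by rewrite sqr_ge0/= -real_normK ?num_real// expr_le1//.
    apply: (@le_trans _ _ ((h ^+ 2) `^ 1)).
      apply: ger_powR (ltW p1); rewrite exprn_even_gt0//= h0.
      by case/andP: hh.
    rewrite powRr1 ?sqr_ge0// -real_normK ?num_real//.
    by apply: le_trans he; rewrite expr2 ler_piMl.
  apply: DeriveDef; first by apply/cvg_ex; exists 0.
  exact/cvg_lim.
have tt : 0 < t ^+ 2 by rewrite exprn_even_gt0.
have d1 : is_derive t 1 (fun t : R => t ^+ 2) (2 * t).
  by apply: is_derive_eq; rewrite /GRing.scale /=; ring.
have d2 := @is_derive1_comp R (fun y => y `^ p) (fun t => t ^+ 2) t _ _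
  (is_derive1_powR p tt) d1.
have d3 := is_deriveM (is_derive_id t (1 : R)) d2.
apply: is_derive_eq d3 _.
rewrite /GRing.scale /=.
have -> : (t ^+ 2) `^ p = t ^+ 2 * (t ^+ 2) `^ (p - 1).
  rewrite -[X in X * _]powRr1 ?sqr_ge0// -powRD ?gt_eqF//.
    by rewrite subrKC.
  by rewrite subrKC; lra.
ring.
Unshelve. all: by end_near. Qed.

Lemma le_increment (R : realType) (F F' H H' : R -> R) (u v : R) : u <= v ->
  {within `[u, v], continuous F} -> {within `[u, v], continuous H} ->
  {in `]u, v[, forall t : R, is_derive t 1 F (F' t)} ->
  {in `]u, v[, forall t : R, is_derive t 1 H (H' t)} ->
  {in `]u, v[, forall t : R, `|F' t| <= H' t} ->
  `|F v - F u| <= H v - H u.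
Proof.
move=> uv cF cH dF dH FH.
have key (G G' : R -> R) : {within `[u, v], continuous G} ->
    {in `]u, v[, forall t : R, is_derive t 1 G (G' t)} ->
    {in `]u, v[, forall t : R, G' t <= H' t} -> G v - G u <= H v - H u.
  move: uv; rewrite le_eqVlt => /predU1P[<- //|uv]; first by rewrite !subrr.
  move=> cG dG GH; rewrite -subr_ge0.
  have [c cuv E] := @MVT _ (H - G) (H' - G') u v uv
    (fun t tuv => is_deriveB (dH t tuv) (dG t tuv)) (within_continuousB cH cG).
  have -> : H v - H u - (G v - G u) = (H - G) v - (H - G) u.
    by transitivity (H v - G v - (H u - G u)); [ring|].
  rewrite E; apply: mulr_ge0; last by rewrite subr_ge0 ltW.
  by rewrite /= subr_ge0; exact: GH.
rewrite ler_norml; apply/andP; split; last first.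
  by apply: key cF dF _ => t tuv; apply: le_trans (FH _ tuv); exact: ler_norm.
rewrite lerNl -[leLHS]/(- (F v + - F u)) opprD.
apply: (key (- F) (- F')).
- by move=> z; apply: continuousN; exact: cF.
- by move=> t tuv; apply: is_deriveN; exact: dF.
- move=> t tuv; apply: le_trans (FH _ tuv).
  by rewrite /= -normrN; exact: ler_norm.
Qed.

Lemma inv_powR (R : realType) (x r : R) : 0 <= x -> x^-1 `^ r = (x `^ r)^-1.
Proof. by move=> x0; rewrite -powR_inv1// powRAC powR_inv1 ?powR_ge0. Qed.

Lemma conjugate_gt1 (R : realType) (p q : R) :
  1 < q -> 1 / p + 1 / q = 1 -> 1 < p.
Proof.
move=> q1 pq.
have ip : p^-1 = 1 - q^-1 by rewrite -[X in X - _]pq !div1r addrK.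
have iq : 0 < q^-1 < 1 by rewrite invr_gt0 invf_lt1//; lra.
have p0 : 0 < p by rewrite -invr_gt0 ip; lra.
by rewrite -invf_lt1// ip; lra.
Qed.

(** Hoelder's and the Hermite-Hadamard inequality in one step, without
    integrals.  The length [D] encodes the position of the centre: the equation
    it satisfies says that the integral of [|t - c|^(2 p)] over [[u, v]] is
    [(v - u) * D^(2 p) / (2 p + 1)].  Thus [D] is the full length [v - u] when
    [c] is an endpoint and half of it when [c] is the midpoint. *)
Lemma increment_bound (R : realType) (p q c D u v : R) (G g : R -> R) :
  1 < q -> 1 / p + 1 / q = 1 ->
  u <= v -> v - u <= 2 * D ->
  (v - c) * ((v - c) ^+ 2) `^ p - (u - c) * ((u - c) ^+ 2) `^ p =
    (v - u) * (D ^+ 2) `^ p ->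
  {within `[u, v], continuous G} ->
  {in `]u, v[, forall t : R, is_derive t 1 G ((t - c) ^+ 2 / 2 * g t)} ->
  concave_function (`[u, v]%classic : set R^o) (fun t => `|g t| `^ q) ->
  `|G v - G u| <=
    D ^+ 2 / (2 * (2 * p + 1) `^ (1 / p)) * (v - u) * `|g ((u + v) / 2)|.
Proof.
move=> q1 pq; rewrite le_eqVlt => /predU1P[<- *|uv uvD Deq cG dG gc].
  by rewrite !subrr mulr0 mul0r normr0.
set m := (u + v) / 2.
have [s gl] := concave_supporting_line gc (mid_in_itvoo uv).
have D0 : 0 < D by lra.
have q0 : 0 < q by lra.
have p1 := conjugate_gt1 q1 pq.
have p0 : 0 < p by lra.
have P0 : 0 < (2 * p + 1) `^ (1 / p) by rewrite powR_gt0; lra.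
have D2 : 0 < (D ^+ 2) `^ p by rewrite powR_gt0// exprn_gt0.
(* A strict upper bound [M] may be divided by even when [g m = 0], and the
   estimate with [|g m|] follows as [M] decreases to it. *)
suff key (M : R) : `|g m| < M ->
    `|G v - G u| <= D ^+ 2 / (2 * (2 * p + 1) `^ (1 / p)) * (v - u) * M.
  have K0 : 0 < D ^+ 2 / (2 * (2 * p + 1) `^ (1 / p)) * (v - u).
    rewrite mulr_gt0// ?subr_gt0// divr_gt0 ?exprn_gt0//; lra.
  rewrite -ler_pdivrMl//; apply/ler_addgt0Pr => e e0.
  by rewrite ler_pdivrMl//; apply: key; rewrite ltrDl.
move=> gM.
have M0 : 0 < M by apply: le_lt_trans gM.
have Mq : 0 < M `^ q by rewrite powR_gt0.
(* [U] is the normalised [L^p] norm of [(t - c)^2] on [[u, v]]. *)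
pose U := D ^+ 2 / (2 * p + 1) `^ (1 / p).
have U0 : 0 < U by rewrite divr_gt0// exprn_gt0.
have Up : U `^ p = (D ^+ 2) `^ p / (2 * p + 1).
  rewrite /U powRM ?sqr_ge0 ?invr_ge0 ?(ltW P0)//; congr (_ * _).
  by rewrite inv_powR ?(ltW P0)// -powRrM div1r mulVf ?gt_eqF// powRr1//; lra.
(* [H'] is [U * M / 2] times Young's bound for the product of [(t - c)^2 / U]
   and [|g t| / M], with the supporting line in place of [|g t|^q]. *)
pose H (t : R) : R := U * M / 2 *
  ((t - c) * ((t - c) ^+ 2) `^ p / ((D ^+ 2) `^ p * p) +
   (t + s * (t - m) ^+ 2 / 2 / M `^ q) / q).
pose H' (t : R) : R := U * M / 2 *
  ((2 * p + 1) * ((t - c) ^+ 2) `^ p / ((D ^+ 2) `^ p * p) +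
   (1 + s * (t - m) / M `^ q) / q).
have dH (t : R) : is_derive t 1 H (H' t).
  have d1 : is_derive t 1 (fun t : R => t - c) 1.
    by apply: is_derive_eq; rewrite subr0.
  have := @is_derive1_comp R (fun t => t * (t ^+ 2) `^ p) (fun t => t - c) t _ _
    (is_derive_mul_sqr_powR (t - c) p1) d1.
  set E := (X in is_derive _ _ X _) => d2.
  have -> : H = (fun t => U * M / 2 * (E t / ((D ^+ 2) `^ p * p) +
    (t + s * (t - m) ^+ 2 / 2 / M `^ q) / q)) by [].
  apply: is_derive_eq; rewrite /GRing.scale /= /H'.
  field.
  by rewrite !gt_eqF.
have -> : D ^+ 2 / (2 * (2 * p + 1) `^ (1 / p)) * (v - u) * M = H v - H u.
  have -> : H v - H u = U * M / 2 * (((v - c) * ((v - c) ^+ 2) `^ p -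
      (u - c) * ((u - c) ^+ 2) `^ p) / ((D ^+ 2) `^ p * p) + (v - u) / q).
    rewrite /H /m; field.
    by rewrite !gt_eqF.
  rewrite Deq.
  have -> : (v - u) * (D ^+ 2) `^ p / ((D ^+ 2) `^ p * p) + (v - u) / q
      = (v - u) * (1 / p + 1 / q) by field; rewrite !gt_eqF.
  by rewrite pq /U; field; rewrite gt_eqF.
apply: (@le_increment _ _ _ _ H' _ _ (ltW uv) cG _ dG) => //.
  by apply: derivable_within_continuous => t _; case: (dH t).
move=> t tuv /=.
have -> : `|(t - c) ^+ 2 / 2 * g t| =
    U * M / 2 * (((t - c) ^+ 2 / U) * (`|g t| / M)).
  rewrite normrM ger0_norm ?divr_ge0 ?sqr_ge0//.
  by field; rewrite !gt_eqF.
have UM : 0 < U * M / 2 by rewrite divr_gt0 // mulr_gt0.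
rewrite /H' (ler_pM2l UM).
have w0 : 0 <= (t - c) ^+ 2 / U by rewrite divr_ge0 ?sqr_ge0 ?(ltW U0).
have y0 : 0 <= `|g t| / M by rewrite divr_ge0 ?(ltW M0).
have pq' : p^-1 + q^-1 = 1 by rewrite -pq !div1r.
apply: le_trans (conjugate_powR w0 y0 p0 q0 pq') _.
rewrite powRM ?sqr_ge0 ?invr_ge0 ?(ltW U0)//.
rewrite [(`|_| / _) `^ _]powRM ?invr_ge0 ?(ltW M0)//.
rewrite !inv_powR ?(ltW U0) ?(ltW M0)// Up.
apply: lerD.
  rewrite le_eqVlt; apply/orP; left; apply/eqP; field.
  by rewrite !gt_eqF//; lra.
rewrite ler_pM2r ?invr_gt0// ler_pdivrMr// mulrDl mul1r divfK ?gt_eqF//.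
apply: le_trans (gl _ (subset_itv_oo_cc tuv)) _; rewrite lerD2r.
by apply: ge0_ler_powR; rewrite ?nnegrE ?(ltW q0) ?(ltW M0) ?(ltW gM).
Qed.

(** * Integration by parts with a quadratic weight *)

(** Two integrations by parts of [(t - c)^2 / 2 * f''(t)], with [g] for the
    derivative of [f]. *)
Definition quadratic_primitive (R : realType) (a : R) (f g : R -> R) (c t : R) :
    R :=
  (t - c) ^+ 2 / 2 * g t - (t - c) * f t +
  \int[@lebesgue_measure R]_(s in `[a, t]) f s.

Lemma continuous_integrable_itv (R : realType) (a b : R) (f : R -> R) :
  {within `[a, b], continuous f} ->
  (@lebesgue_measure R).-integrable `[a, b] (EFin \o f).
Proof.
move=> cf; apply: continuous_compact_integrable => //.
exact: segment_compact.
Qed.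

Lemma within_continuous_quadratic_primitive (R : realType) (a b c : R)
    (f g : R -> R) :
  a < b -> {within `[a, b], continuous f} ->
  {within `[a, b], continuous g} ->
  {within `[a, b], continuous quadratic_primitive a f g c}.
Proof.
move=> ab cf cg.
have cI : {within `[a, b],
    continuous (fun t => \int[@lebesgue_measure R]_(s in `[a, t]) f s)}.
  exact: parameterized_integral_continuous (ltW ab)
    (continuous_integrable_itv cf).
apply/subspace_continuousP => t tab.
have cB : (fun s : R => s - c) @ within `[a, b] (nbhs t) --> t - c.
  by apply: cvgB; [exact: cvg_within|exact: cvg_cst].
move/subspace_continuousP : cI => /(_ t tab) cI.
move/subspace_continuousP : cf => /(_ t tab) cft.
move/subspace_continuousP : cg => /(_ t tab) cg.
apply: cvgD cI; apply: cvgB; last exact: cvgM cB cft.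
apply: cvgM cg; apply: cvgM; last exact: cvg_cst.
exact: (cvgM cB cB).
Qed.

Lemma is_derive_quadratic_primitive (R : realType) (a b c t : R)
    (f g g' : R -> R) :
  {within `[a, b], continuous f} -> t \in `]a, b[ ->
  is_derive t 1 f (g t) -> is_derive t 1 g (g' t) ->
  is_derive t 1 (quadratic_primitive a f g c) ((t - c) ^+ 2 / 2 * g' t).
Proof.
move=> cf /[dup] tab; rewrite in_itv/= => /andP[at_ tb] df dg.
have cft : {for t, continuous f}.
  by apply/differentiable_continuous/derivable1_diffP; case: df.
have [dI dIE] :=
  continuous_FTC1_closed tb (continuous_integrable_itv cf) at_ cft.
have {}dI :
    is_derive t 1 (fun t => \int[@lebesgue_measure R]_(s in `[a, t]) f s) (f t).
  by apply: DeriveDef; rewrite -?derive1E.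
rewrite /quadratic_primitive.
set I := (fun t => \int[@lebesgue_measure R]_(s in `[a, t]) f s) in dI *.
have -> : (fun t => (t - c) ^+ 2 / 2 * g t - (t - c) * f t
    + \int[@lebesgue_measure R]_(s in `[a, t]) f s) =
  (fun t => (t - c) ^+ 2 / 2 * g t - (t - c) * f t + I t) by [].
apply: is_derive_eq; rewrite /GRing.scale /=.
by field.
Qed.

(** * The quadrature estimate *)

Theorem theorem5 (R : realType) (a b : R) (f : R -> R) (p q : R) :
  let f' := derive1_within `[a, b] f in
  let f'' := derive1_within `[a, b] f' in
  a < b ->
  (forall t, t \in `[a, b] -> derivable1_within `[a, b] f t) ->
  absolutely_continuous a b f' ->
  (forall t, t \in `[a, b] -> derivable1_within `[a, b] f' t) ->
  (@lebesgue_measure R).-integrable `[a, b] (EFin \o f'') ->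
  1 < q ->
  1 / p + 1 / q = 1 ->
  concave_function (`[a, b]%classic : set R^o) (fun t => `|f'' t| `^ q) ->
  forall x, x \in `[a, (a + b) / 2] ->
    `| 1 / (b - a) * (\int[@lebesgue_measure R]_(t in `[a, b]) f t)
       - 1 / 2 * (f x + f (a + b - x))
       + 1 / 2 * (x - (3 * a + b) / 4) * (f' x - f' (a + b - x)) |
    <= 1 / (2 * (b - a) * (2 * p + 1) `^ (1 / p)) *
       ( (x - a) ^+ 3 * `|f'' ((x + a) / 2)|
       + (a + b - 2 * x) ^+ 3 / 4 * `|f'' ((a + b) / 2)|
       + (x - a) ^+ 3 * `|f'' ((a + 2 * b - x) / 2)| ).
Proof.
move=> f' f'' ab df _ df' _ q1 pq hc x; rewrite in_itv/= => /andP[ax xm].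
set y := a + b - x; set m := (a + b) / 2 in xm *.
have xy : x <= y by rewrite /y; move: xm; rewrite /m; lra.
have yb : y <= b by rewrite /y; lra.
have ay : a <= y by exact: le_trans xy.
have xb : x <= b by exact: le_trans yb.
have ba0 : 0 < b - a by rewrite subr_gt0.
have a2 : x - a <= 2 * (x - a) by lra.
have b2 : b - y <= 2 * (b - y) by lra.
have m2 : y - x <= 2 * ((y - x) / 2) by lra.
have p1 := conjugate_gt1 q1 pq.
have P0 : 0 < (2 * p + 1) `^ (1 / p) by rewrite powR_gt0; lra.
have cf : {within `[a, b], continuous f}.
  by apply: derivable1_within_continuous => t; rewrite inE; exact: df.
have cf' : {within `[a, b], continuous f'}.
  by apply: derivable1_within_continuous => t; rewrite inE; exact: df'.
pose G := quadratic_primitive a f f'.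
have bound c D u v : a <= u -> u <= v -> v <= b -> v - u <= 2 * D ->
    (v - c) * ((v - c) ^+ 2) `^ p - (u - c) * ((u - c) ^+ 2) `^ p =
      (v - u) * (D ^+ 2) `^ p ->
    `|G c v - G c u| <=
      D ^+ 2 / (2 * (2 * p + 1) `^ (1 / p)) * (v - u) * `|f'' ((u + v) / 2)|.
  move=> au uv vb uvD Deq.
  have uvab : `[u, v]%classic `<=` `[a, b]%classic.
    by apply: subset_itv; rewrite bnd_simp.
  apply: (increment_bound q1 pq uv uvD Deq).
  - apply: continuous_subspaceW uvab _.
    exact: within_continuous_quadratic_primitive.
  - move=> t; rewrite in_itv/= => /andP[ut tv].
    have tab : t \in `]a, b[.
      by rewrite in_itv/= (le_lt_trans au)// (lt_le_trans tv).
    have tab' : t \in `[a, b] by exact: subset_itv_oo_cc.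
    apply: (is_derive_quadratic_primitive _ cf tab).
    + by apply: derive1_within_interior tab _; exact: df.
    + by apply: derive1_within_interior tab _; exact: df'.
  - exact: sub_concave_function hc.
have left : `|G a x - G a a| <= (x - a) ^+ 2 / (2 * (2 * p + 1) `^ (1 / p)) *
    (x - a) * `|f'' ((a + x) / 2)|.
  by apply: bound => //; rewrite subrr mul0r subr0.
have middle : `|G m y - G m x| <= ((y - x) / 2) ^+ 2 /
    (2 * (2 * p + 1) `^ (1 / p)) * (y - x) * `|f'' ((x + y) / 2)|.
  apply: bound => //.
  have -> : y - m = (y - x) / 2 by rewrite /y /m; field.
  have -> : x - m = - ((y - x) / 2) by rewrite /y /m; field.
  by rewrite sqrrN; field.
have right : `|G b b - G b y| <= (b - y) ^+ 2 / (2 * (2 * p + 1) `^ (1 / p)) *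
    (b - y) * `|f'' ((y + b) / 2)|.
  apply: bound => //.
  by rewrite subrr mul0r -[y - b]opprB sqrrN mulNr opprK add0r.
clear bound.
have -> : 1 / (b - a) * (\int[@lebesgue_measure R]_(t in `[a, b]) f t)
    - 1 / 2 * (f x + f y) + 1 / 2 * (x - (3 * a + b) / 4) * (f' x - f' y) =
    1 / (b - a) * ((G a x - G a a) + (G m y - G m x) + (G b b - G b y)).
  have Ga : \int[@lebesgue_measure R]_(t in `[a, a]) f t = 0.
    by rewrite set_itv1 Rintegral_set1.
  rewrite /G /quadratic_primitive Ga.
  (* The identity depends on [y] in the coefficients only: the values of [f]
     and [f'] at [y] are abstracted before [y] is expanded. *)
  move: (f y) (f' y) => fy f'y; rewrite /y /m.
  by field; rewrite gt_eqF.
have -> : 1 / (2 * (b - a) * (2 * p + 1) `^ (1 / p)) *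
    ((x - a) ^+ 3 * `|f'' ((x + a) / 2)| +
     (a + b - 2 * x) ^+ 3 / 4 * `|f'' m| +
     (x - a) ^+ 3 * `|f'' ((a + 2 * b - x) / 2)|) =
    1 / (b - a) *
    ((x - a) ^+ 2 / (2 * (2 * p + 1) `^ (1 / p)) * (x - a) *
       `|f'' ((a + x) / 2)| +
     ((y - x) / 2) ^+ 2 / (2 * (2 * p + 1) `^ (1 / p)) * (y - x) *
       `|f'' ((x + y) / 2)| +
     (b - y) ^+ 2 / (2 * (2 * p + 1) `^ (1 / p)) * (b - y) *
       `|f'' ((y + b) / 2)|).
  have -> : (x + y) / 2 = m by rewrite /y /m; field.
  have -> : (y + b) / 2 = (a + 2 * b - x) / 2 by rewrite /y; field.
  have -> : b - y = x - a by rewrite /y; ring.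
  have -> : y - x = a + b - 2 * x by rewrite /y; ring.
  by rewrite [x + a]addrC; field; rewrite !gt_eqF.
have iba : 0 < 1 / (b - a) by rewrite divr_gt0.
rewrite normrM (gtr0_norm iba) (ler_pM2l iba).
apply: le_trans (ler_normD _ _) (lerD _ right).
exact: le_trans (ler_normD _ _) (lerD left middle).
Qed.
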